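(* Let $d\ge 1$, let $\Omega=\operatorname{diag}(\omega_j)_{j=1}^d\in\mathbb{R}^{d\times d}$ with all $\omega_j\ge 0$, let $\omega=\min_{j:\,\omega_j>0}\omega_j$ be the smallest nonzero frequency, and let $A\in\mathbb{C}^{d\times d}$ be self-adjoint. Let $0<h\le 1$ and let $\psi_1,\phi\colon\mathbb{R}\to\mathbb{R}$ be even functions such that $\psi_1(\xi)=\operatorname{sinc}(\xi)\phi(\xi)$ for all $\xi\in\mathbb{R}$ and, for constants $c_0,c_1\ge 0$, \[ |\psi_1(\xi)|\le c_0,\qquad |\phi(\xi)|\le c_0,\qquad |\phi(\xi)-1|\le c_1|\xi|\qquad\text{for all }\xi\in\mathbb{R}. \] Set $\Psi_1=\psi_1(h\Omega)$, $\Phi=\phi(h\Omega)$. For given $q_0,\dot q_0\in\mathbb{C}^d$, define $(q_n,\dot q_n)_{n\ge 0}$ recursively by \begin{align*} q_{n+1} &= \cos(h\Omega) q_n + h\operatorname{sinc}(h\Omega) \dot{q}_n - \tfrac12 h^2 \operatorname{sinc}(h\Omega) \Psi_1 A\Phi q_n,\\ \dot{q}_{n+1} &= -\Omega \sin(h\Omega) q_n + \cos(h\Omega) \dot{q}_n - \tfrac12 h \big( \cos(h\Omega) \Psi_1 A\Phi q_n + \Psi_1 A\Phi q_{n+1}\big), \end{align*} and let $H(q,\dot q)=\tfrac12 \|\Omega q\|^2 + \tfrac12 \|\dot{q}\|^2 + \tfrac12 q^*Aq$. Then \[ \big|H(q_n,\dot{q}_n) - H(q_0,\dot{q}_0)\big|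 \le C \min\big(h,\omega^{-1}\big) + C h^2 \qquad\text{for all } n\in\mathbb{N}, \] with a constant $C$ depending only on $c_0$, $c_1$, $\|A\|$, $\|q_0\|$, $\|\Omega q_0\|$, $\|\dot{q}_0\|$ and $\|q_n\|$.
   Context: $\|\cdot\|$ is the Euclidean norm on $\mathbb{C}^d$ and, for matrices, the induced operator norm; ${}^*$ denotes conjugate transpose. $\operatorname{sinc}(\xi)=\sin(\xi)/\xi$ for $\xi\ne0$ and $\operatorname{sinc}(0)=1$. For a function $f\colon\mathbb{R}\to\mathbb{R}$, $f(h\Omega)$ denotes the diagonal matrix $\operatorname{diag}(f(h\omega_j))_{j=1}^d$. *)

(* Defs.v *)
From HB Require Import structures.
From mathcomp Require Import all_boot all_algebra.
From mathcomp Require Import all_classical all_reals all_analysis.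
From mathcomp Require Import complex.

Set Implicit Arguments.
Unset Strict Implicit.
Unset Printing Implicit Defensive.

Import GRing.Theory Num.Theory.
Local Open Scope ring_scope.
Local Open Scope classical_set_scope.

Section GautschiDefs.
Variable R : realType.

Definition cR (x : R) : R[i] := (x%:C)%C.

Definition cabs (z : R[i]) : R := Normc.normc z.

Definition sinc (x : R) : R := if x == 0 then 1 else sin x / x.

Definition Omega (d : nat) (om : 'I_d -> R) : 'M[R[i]]_d :=
  diag_mx (\row_j cR (om j)).

Definition fhOm (d : nat) (f : R -> R) (h : R) (om : 'I_d -> R) : 'M[R[i]]_d :=
  diag_mx (\row_j cR (f (h * om j))).

Definition vnorm (d : nat) (v : 'cV[R[i]]_d) : R :=
  Num.sqrt (\sum_i cabs (v i 0) ^+ 2).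

Definition opnorm (d : nat) (A : 'M[R[i]]_d) : R :=
  sup [set r | exists v : 'cV[R[i]]_d, vnorm v <= 1 /\ r = vnorm (A *m v)].

Definition adj (m n : nat) (M : 'M[R[i]]_(m, n)) : 'M[R[i]]_(n, m) :=
  (map_mx conjc M)^T.

Definition selfadjoint (d : nat) (A : 'M[R[i]]_d) : Prop := adj A = A.

Definition energy (d : nat) (om : 'I_d -> R) (A : 'M[R[i]]_d)
    (q qd : 'cV[R[i]]_d) : R[i] :=
  cR (1 / 2 * vnorm (Omega om *m q) ^+ 2) + cR (1 / 2 * vnorm qd ^+ 2)
  + cR (1 / 2) * (adj q *m A *m q) 0 0.

Definition gstep (d : nat) (om : 'I_d -> R) (A : 'M[R[i]]_d) (h : R)
    (psi1 phi : R -> R) (p : 'cV[R[i]]_d * 'cV[R[i]]_d) :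
    'cV[R[i]]_d * 'cV[R[i]]_d :=
  let q := p.1 in let qd := p.2 in
  let cosM := fhOm cos h om in
  let sinM := fhOm sin h om in
  let sincM := fhOm sinc h om in
  let Psi1 := fhOm psi1 h om in
  let Phi := fhOm phi h om in
  let q' := cosM *m q + cR h *: (sincM *m qd)
            - cR (1 / 2 * h ^+ 2) *: (sincM *m Psi1 *m A *m Phi *m q) in
  let qd' := - (Omega om *m sinM *m q) + cosM *m qd
             - cR (1 / 2 * h) *: (cosM *m Psi1 *m A *m Phi *m q
                                  + Psi1 *m A *m Phi *m q') in
  (q', qd').

Definition traj (d : nat) (om : 'I_d -> R) (A : 'M[R[i]]_d) (h : R)
    (psi1 phi : R -> R) (q0 qd0 : 'cV[R[i]]_d) (n : nat) :=
  iter n (gstep om A h psi1 phi) (q0, qd0).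

(* smallest nonzero frequency omega = min_{j : omega_j > 0} omega_j
   (the initial value of the fold is max_j omega_j, which does not
   affect the result when some omega_j > 0) *)
Definition minfreq (d : nat) (om : 'I_d -> R) : R :=
  \big[Num.min/ \big[Num.max/0]_j om j]_(j | 0 < om j) om j.

(* min(h, omega^{-1}); with the convention omega = +oo (omega^{-1} = 0)
   when all frequencies vanish *)
Definition min_h_invom (d : nat) (om : 'I_d -> R) (h : R) : R :=
  if [exists j, 0 < om j] then Num.min h (minfreq om)^-1 else 0.

End GautschiDefs.

(* Main.v *)
Require Import Defs.
From HB Require Import structures.
From mathcomp Require Import all_boot all_order all_algebra.
From mathcomp Require Import all_classical all_reals all_analysis.
From mathcomp Require Import complex.
From mathcomp Require Import ring lra.
Import Order.TTheory GRing.Theory Num.Theory.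
Import numFieldNormedType.Exports.
Local Open Scope ring_scope.

Set Implicit Arguments.
Unset Strict Implicit.
Unset Printing Implicit Defensive.

(** Since psi_1 = sinc phi, the scheme is a half kick, an exact rotation and a
    half kick with force -sinc(h Omega) B q, where B = Phi A Phi is self-adjoint.
    Hence twice the modified energy

      |p|^2 + |Omega q|^2 + Re <cos(h Omega) q, B q> - h^2/4 |sinc(h Omega) B q|^2

    is conserved exactly: expanding the kicks, at the old time it equals
    |p+|^2 + |Omega q|^2 + Re <q', B q>, where p+ is the momentum after the first
    half kick; the rotation preserves the first two terms, and the third is
    symmetric under exchange of the old and the new position.  Conservation also
    bounds |Omega q_n|.  The difference to the true energy is O(h^2) plus
    Re <q, A q> - Re <cos Phi q, A Phi q>; the filters 1 - phi and 1 - phi cos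
    vanish at 0, are bounded and Lipschitz at 0, so they map q to a vector of
    norm at most L min(h, 1/omega) |Omega q|. *)

(** * Complex vectors as a real Euclidean space *)

Section ComplexVectors.
Variable R : realType.
Implicit Types (z : R[i]) (x : R).

Lemma Re_add z1 z2 : complex.Re (z1 + z2) = complex.Re z1 + complex.Re z2.
Proof. by case: z1 z2 => [? ?] []. Qed.

Lemma Im_add z1 z2 : complex.Im (z1 + z2) = complex.Im z1 + complex.Im z2.
Proof. by case: z1 z2 => [? ?] []. Qed.

Lemma Re_opp z : complex.Re (- z) = - complex.Re z.
Proof. by case: z. Qed.

Lemma Im_opp z : complex.Im (- z) = - complex.Im z.
Proof. by case: z. Qed.

Lemma Re_scale x z : complex.Re (cR x * z) = x * complex.Re z.
Proof. by case: z => a b /=; rewrite mul0r subr0. Qed.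

Lemma Im_scale x z : complex.Im (cR x * z) = x * complex.Im z.
Proof. by case: z => a b /=; rewrite mul0r addr0. Qed.

Definition ReImE := (Re_add, Im_add, Re_opp, Im_opp, Re_scale, Im_scale).

Lemma Re_sum (I : finType) (F : I -> R[i]) :
  complex.Re (\sum_i F i) = \sum_i complex.Re (F i).
Proof. by rewrite (big_morph _ Re_add (erefl : complex.Re 0 = 0)). Qed.

Lemma cabs_cR x : cabs (cR x) = `|x|.
Proof. by rewrite /cabs /= expr0n addr0 sqrtr_sqr. Qed.

Lemma cabs_cRB x y : cabs (cR x - cR y) = `|x - y|.
Proof. by rewrite /cR -rmorphB -cabs_cR. Qed.

Section Dimension.
Variable d : nat.
Implicit Types (u v w : 'cV[R[i]]_d) (A : 'M[R[i]]_d) (a b : 'I_d -> R).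

(* The real part of the Hermitian product. *)
Definition rip u v : R :=
  \sum_i (complex.Re (u i 0) * complex.Re (v i 0)
          + complex.Im (u i 0) * complex.Im (v i 0)).

Lemma ripC u v : rip u v = rip v u.
Proof. by apply: eq_bigr => i _; ring. Qed.

Lemma ripDr u v w : rip u (v + w) = rip u v + rip u w.
Proof.
rewrite /rip -big_split; apply: eq_bigr => i _ /=.
by rewrite !mxE !ReImE; ring.
Qed.

Lemma ripNr u v : rip u (- v) = - rip u v.
Proof.
rewrite /rip -sumrN; apply: eq_bigr => i _ /=.
by rewrite !mxE !ReImE; ring.
Qed.

Lemma ripZr u v x : rip u (cR x *: v) = x * rip u v.
Proof.
rewrite /rip mulr_sumr; apply: eq_bigr => i _ /=.
by rewrite !mxE !ReImE; ring.
Qed.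

Lemma ripBr u v w : rip u (v - w) = rip u v - rip u w.
Proof. by rewrite ripDr ripNr. Qed.

Lemma ripBl u v w : rip (v - w) u = rip v u - rip w u.
Proof. by rewrite ripC ripBr ![rip u _]ripC. Qed.

Lemma ripZl u v x : rip (cR x *: v) u = x * rip v u.
Proof. by rewrite ripC ripZr ripC. Qed.

Lemma rip_ge0 u : 0 <= rip u u.
Proof. by apply: sumr_ge0 => i _; rewrite -!expr2 addr_ge0 ?sqr_ge0. Qed.

Lemma vnormE u : vnorm u = Num.sqrt (rip u u).
Proof.
congr (Num.sqrt _); apply: eq_bigr => i _.
rewrite /cabs; case: (u i 0) => x y /=.
by rewrite sqr_sqrtr ?addr_ge0 ?sqr_ge0 // -!expr2.
Qed.

Lemma vnorm_ge0 u : 0 <= vnorm u.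
Proof. by rewrite vnormE sqrtr_ge0. Qed.

Lemma vnorm_sqr u : vnorm u ^+ 2 = rip u u.
Proof. by rewrite vnormE sqr_sqrtr ?rip_ge0. Qed.

Lemma vnorm_le u x : 0 <= x -> rip u u <= x ^+ 2 -> vnorm u <= x.
Proof. by move=> x0 ux; rewrite vnormE -(ger0_norm x0) -sqrtr_sqr ler_wsqrtr. Qed.

Lemma vnorm_le_sqrt u x : vnorm u ^+ 2 <= x -> vnorm u <= Num.sqrt x.
Proof. by rewrite vnorm_sqr vnormE; exact: ler_wsqrtr. Qed.

Lemma vnormZ x u : vnorm (cR x *: u) = `|x| * vnorm u.
Proof. by rewrite !vnormE ripZl ripZr mulrA -expr2 sqrtrM ?sqr_ge0 // sqrtr_sqr. Qed.

Lemma vnorm_eq0 u : vnorm u = 0 -> u = 0.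
Proof.
move=> u0; have /eqP : rip u u = 0 by rewrite -vnorm_sqr u0 expr0n.
rewrite psumr_eq0 => [/allP u00|i _]; last by rewrite -!expr2 addr_ge0 ?sqr_ge0.
apply/matrixP => i j; rewrite (ord1 j) mxE.
have := u00 i (mem_index_enum _); case: (u i 0) => x y /=.
rewrite -!expr2 paddr_eq0 ?sqr_ge0 // !sqrf_eq0.
by case/andP => /eqP -> /eqP ->.
Qed.

Lemma rip_CauchySchwarz u v : `|rip u v| <= vnorm u * vnorm v.
Proof.
have U := vnorm_ge0 u; have V := vnorm_ge0 v.
have [/vnorm_eq0 ->|v0] := eqVneq (vnorm v) 0.
  rewrite [X in `|X|]big1 ?normr0 ?mulr_ge0 ?vnorm_ge0// => i _.
  by rewrite !mxE /= !mulr0 addr0.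
have Vp : 0 < vnorm v ^+ 2 by rewrite exprn_gt0 // lt_def v0.
rewrite -(ger0_norm (mulr_ge0 U V)) -ler_sqr ?nnegrE //.
rewrite !real_normK ?num_real //.
rewrite exprMn -(ler_pM2r Vp).
(* The squared norm of |v|^2 u - <u,v> v expands to |v|^2 (|u|^2 |v|^2 - <u,v>^2), which avoids any
   division. *)
have := rip_ge0 (cR (vnorm v ^+ 2) *: u - cR (rip u v) *: v).
rewrite !ripBl !ripBr !ripZl !ripZr -!vnorm_sqr (ripC v u); nra.
Qed.

Lemma rip_adj u v : rip u v = complex.Re ((adj u *m v) 0 0).
Proof.
rewrite mxE Re_sum; apply: eq_bigr => i _; rewrite !mxE.
by case: (u i 0) (v i 0) => a b [a' b'] /=; ring.
Qed.

Lemma adj_mul (m n p : nat) (M : 'M[R[i]]_(m, n)) (N : 'M[R[i]]_(n, p)) :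
  adj (M *m N) = adj N *m adj M.
Proof. by rewrite /adj map_mxM trmx_mul. Qed.

Lemma adjK (m n : nat) (M : 'M[R[i]]_(m, n)) : adj (adj M) = M.
Proof. by apply/matrixP => i j; rewrite !mxE conjcK. Qed.

Lemma rip_selfadjoint A u v : selfadjoint A -> rip u (A *m v) = rip (A *m u) v.
Proof. by move=> Asa; rewrite !rip_adj adj_mul Asa mulmxA. Qed.

(** A one-by-one matrix equal to its own adjoint has zero imaginary part. This makes the
    complex-valued [energy] a real quantity. *)
Lemma quadratic_form_real A u : selfadjoint A ->
  (adj u *m A *m u) 0 0 = cR (rip u (A *m u)).
Proof.
move=> Asa; rewrite rip_adj mulmxA.
have : adj (adj u *m A *m u) = adj u *m A *m u by rewrite !adj_mul adjK Asa mulmxA.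
move: (_ *m u) => M /matrixP /(_ 0 0); rewrite !mxE.
case: (M 0 0) => x y /(congr1 (@complex.Im R)) /= yN.
by have -> : y = 0 by lra.
Qed.

Lemma energyE om A u v : selfadjoint A -> energy om A u v =
  cR (1 / 2 * (rip (Omega om *m u) (Omega om *m u) + rip v v + rip u (A *m u))).
Proof.
by move=> Asa; rewrite /energy quadratic_form_real // !vnorm_sqr /cR -rmorphM -!rmorphD !mulrDr.
Qed.

(** Both [Omega om] and [fhOm f h om] unfold to this form, so the lemmas on [rdiag] apply to them
    directly. *)
Definition rdiag a : 'M[R[i]]_d := diag_mx (\row_j cR (a j)).

Lemma rdiagE a u i : (rdiag a *m u) i 0 = cR (a i) * u i 0.
Proof. by rewrite mul_diag_mx !mxE. Qed.

Lemma rip_rdiag a u v : rip u (rdiag a *m v) = rip (rdiag a *m u) v.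
Proof. by apply: eq_bigr => i _; rewrite !rdiagE !ReImE; ring. Qed.

Lemma rdiag1 u : rdiag (fun=> 1) *m u = u.
Proof. by apply/colP => i; rewrite rdiagE mul1r. Qed.

Lemma rdiagM a b u : rdiag a *m (rdiag b *m u) = rdiag (fun j => a j * b j) *m u.
Proof. by apply/colP => i; rewrite !rdiagE mulrA /cR rmorphM. Qed.

Lemma rdiagB a b u : rdiag a *m u - rdiag b *m u = rdiag (fun j => a j - b j) *m u.
Proof.
by apply/colP => i; rewrite [LHS]mxE [(- _ : 'cV_d) _ _]mxE !rdiagE /cR rmorphB mulrBl.
Qed.

(** Diagonal matrices act entry by entry, so domination of the entries passes to the norms. With
    [b := om] this bounds a filter in terms of |Omega q|, with [b := 1] in terms of |q|. *)
Lemma vnorm_rdiag_le a b (M : R) u : 0 <= M ->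
  (forall j, `|a j| <= M * `|b j|) -> vnorm (rdiag a *m u) <= M * vnorm (rdiag b *m u).
Proof.
move=> M0 ab; apply: vnorm_le; first by rewrite mulr_ge0 ?vnorm_ge0.
rewrite exprMn vnorm_sqr mulr_sumr; apply: ler_sum => i _.
have : a i ^+ 2 <= (M * b i) ^+ 2.
  by rewrite -[leLHS]real_normK ?num_real // -[leRHS]real_normK ?num_real // normrM (ger0_norm M0) ler_sqr ?nnegrE ?mulr_ge0.
rewrite !rdiagE !ReImE -[_ * _ * _ + _](_ : a i ^+ 2 * (complex.Re (u i 0) ^+ 2 + complex.Im (u i 0) ^+ 2) = _); last by ring.
move=> /ler_wpM2r le1; apply: le_trans (le1 _ _) _; first by rewrite addr_ge0 ?sqr_ge0.
by rewrite le_eqVlt; apply/orP; left; apply/eqP; ring.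
Qed.

Lemma vnorm_rdiag_le_id a (M : R) u : 0 <= M ->
  (forall j, `|a j| <= M) -> vnorm (rdiag a *m u) <= M * vnorm u.
Proof.
move=> M0 aM; rewrite -[u in leRHS]rdiag1; apply: vnorm_rdiag_le => // j.
by rewrite normr1 mulr1.
Qed.


(** * The operator norm *)

Lemma cabs_sum (I : finType) (F : I -> R[i]) : cabs (\sum_i F i) <= \sum_i cabs (F i).
Proof.
elim/big_rec2: _ => [|i y z _ le_zy]; first by rewrite /cabs Normc.normc0.
by apply: (le_trans (y := cabs (F i) + cabs z)); [exact: le_normcD | rewrite lerD2l].
Qed.

Lemma cabs_ge0 z : 0 <= cabs z.
Proof. by case: z => x y; rewrite sqrtr_ge0. Qed.

Lemma cabs_le_vnorm u i : cabs (u i 0) <= vnorm u.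
Proof.
rewrite -(ger0_norm (cabs_ge0 _)) -sqrtr_sqr ler_wsqrtr // (bigD1 i) //=.
by rewrite lerDl sumr_ge0 // => j _; rewrite sqr_ge0.
Qed.

(** Entries of a vector in the unit ball have modulus at most 1, so row sums of moduli bound the
    image. Hence the [sup] in [opnorm] is a genuine upper bound and not a default value. *)
Lemma vnorm_mulmx_unit_ball A :
  has_ubound [set r | exists v : 'cV[R[i]]_d, vnorm v <= 1 /\ r = vnorm (A *m v)]%classic.
Proof.
exists (Num.sqrt (\sum_i (\sum_j cabs (A i j)) ^+ 2)) => _ [v [v1 ->]].
rewrite ler_wsqrtr // ler_sum // => i _.
rewrite ler_sqr ?nnegrE ?cabs_ge0 ?sumr_ge0 //; last by move=> *; exact: cabs_ge0.
rewrite mxE; apply: (le_trans (cabs_sum _)); apply: ler_sum => j _.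
rewrite /cabs Normc.normcM -[leRHS]mulr1 ler_wpM2l ?cabs_ge0 //.
exact: le_trans (cabs_le_vnorm _ _) v1.
Qed.

Lemma opnorm_ge0 A : 0 <= opnorm A.
Proof.
apply: le_trans (vnorm_ge0 (A *m 0)) _.
apply: (ub_le_sup (vnorm_mulmx_unit_ball A)); exists 0; split=> //.
by rewrite vnormE /rip big1 ?sqrtr0 // => i _; rewrite !mxE /= !mulr0 addr0.
Qed.

Lemma vnorm_mulmx A u : vnorm (A *m u) <= opnorm A * vnorm u.
Proof.
have [/vnorm_eq0 ->|u0] := eqVneq (vnorm u) 0.
  rewrite mulmx0 [leLHS](_ : _ = 0) ?mulr_ge0 ?opnorm_ge0 ?vnorm_ge0 //.
  by rewrite vnormE /rip big1 ?sqrtr0 // => i _; rewrite !mxE /= !mulr0 addr0.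
have up : 0 < vnorm u by rewrite lt_def u0 vnorm_ge0.
rewrite -ler_pdivrMr //.
apply: (ub_le_sup (vnorm_mulmx_unit_ball A)).
(* Homogeneity reduces the claim to the normalised vector u / |u|. *)
exists (cR (vnorm u)^-1 *: u); rewrite -scalemxAr !vnormZ.
by rewrite ger0_norm ?invr_ge0 ?vnorm_ge0 // mulVf // mulrC.
Qed.

End Dimension.
End ComplexVectors.

(** * Elementary facts on sine and cosine *)

Section Trigonometry.
Variable R : realType.
Implicit Types x : R.

Lemma mul_sinc x : x * sinc x = sin x.
Proof.
rewrite /sinc; case: eqP => [->|/eqP x0]; first by rewrite sin0 mul0r.
by rewrite mulrC divfK.
Qed.

Lemma one_sub_cos_le x : 0 <= x -> `|1 - cos x| <= x.
Proof.
move=> x0; have [|c _] := @MVT_segment R cos (fun t => - sin t) 0 x x0.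
  by apply: continuous_subspaceT; exact: continuous_cos.
rewrite cos0 subr0 => cE; rewrite distrC cE normrM normrN (ger0_norm x0).
by rewrite -[leRHS]mul1r ler_wpM2r ?sin_max.
Qed.

End Trigonometry.

(** * Exact conservation of the modified energy *)

Section ModifiedEnergy.
Variable R : realType.

(** Here [w] and [w'] stand for the forces B q and B q' at the old and new positions. The cross
    terms [q' * w] and [q * w'] need not agree in a single component, so both are kept until the
    components are summed. The two sides differ by a multiple of c^2 + s^2 - 1. *)
Lemma rotation_step_component (h om c s S q p w q' p' w' : R) :
  h * om * S = s -> c ^+ 2 + s ^+ 2 = 1 ->
  q' = c * q + h * (S * p) - 1 / 2 * h ^+ 2 * (S * (S * w)) ->
  p' = - (om * (s * q)) + c * p - 1 / 2 * h * (c * (S * w) + S * w') ->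
  p' * p' + om * q' * (om * q') + c * q' * w' + - (h ^+ 2 / 4) * (S * w' * (S * w')) + q' * w
  = p * p + om * q * (om * q) + c * q * w + - (h ^+ 2 / 4) * (S * w * (S * w)) + q * w'.
Proof.
move=> <- cs -> ->; apply/eqP; rewrite -subr_eq0; apply/eqP.
(* [p - h/2 S w] is the momentum after the first half kick. *)
transitivity ((c ^+ 2 + (h * om * S) ^+ 2 - 1) *
  ((p - 1 / 2 * h * (S * w)) ^+ 2 + (om * q) ^+ 2 + q * w')); last by rewrite cs subrr mul0r.
by field.
Qed.

Variable d : nat.
Implicit Types (q p w : 'cV[R[i]]_d).
Variables (om : 'I_d -> R) (A : 'M[R[i]]_d) (h : R) (psi1 phi : R -> R).

(** The force [w] is a free argument: the balance over one step needs no relation between force and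
    position. *)
Definition modified_form q p w : R :=
  rip p p + rip (Omega om *m q) (Omega om *m q) + rip (fhOm (@cos R) h om *m q) w
  + - (h ^+ 2 / 4) * rip (fhOm (@sinc R) h om *m w) (fhOm (@sinc R) h om *m w).

Lemma rotation_step q p w q' p' w' :
  q' = fhOm (@cos R) h om *m q + cR h *: (fhOm (@sinc R) h om *m p)
       - cR (1 / 2 * h ^+ 2) *: (fhOm (@sinc R) h om *m (fhOm (@sinc R) h om *m w)) ->
  p' = - (Omega om *m (fhOm (@sin R) h om *m q)) + fhOm (@cos R) h om *m p
       - cR (1 / 2 * h) *: (fhOm (@cos R) h om *m (fhOm (@sinc R) h om *m w)
                            + fhOm (@sinc R) h om *m w') ->
  modified_form q' p' w' + rip q' w = modified_form q p w + rip q w'.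
Proof.
move=> q'E p'E; rewrite /modified_form /rip !mulr_sumr -!big_split /=.
apply: eq_bigr => i _; rewrite !rdiagE !ReImE.
have combq (u v t : 'cV[R[i]]_d) (x y : R[i]) :
  (u + x *: v - y *: t) i 0 = u i 0 + x * v i 0 - y * t i 0 by rewrite !mxE.
have combp (u v t1 t2 : 'cV[R[i]]_d) (y : R[i]) :
  (- u + v - y *: (t1 + t2)) i 0 = - u i 0 + v i 0 - y * (t1 i 0 + t2 i 0) by rewrite !mxE.
have {}q'E := congr1 (fun v : 'cV_d => v i 0) q'E.
have {}p'E := congr1 (fun v : 'cV_d => v i 0) p'E.
rewrite /= combq !rdiagE in q'E; rewrite /= combp !rdiagE in p'E.
have cs : cos (h * om i) ^+ 2 + sin (h * om i) ^+ 2 = 1 by exact: cos2Dsin2.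
have sE := mul_sinc (h * om i).
(* All filters have real entries, so real and imaginary parts obey the same scalar recursion
   separately. *)
have [Rq Rp] := (congr1 (@complex.Re R) q'E, congr1 (@complex.Re R) p'E).
have [Iq Ip] := (congr1 (@complex.Im R) q'E, congr1 (@complex.Im R) p'E).
rewrite !ReImE in Rq Rp Iq Ip.
have := rotation_step_component sE cs Rq Rp; have := rotation_step_component sE cs Iq Ip.
by lra.
Qed.

Definition filtered_force q := fhOm phi h om *m (A *m (fhOm phi h om *m q)).

Definition modified_energy q p : R := modified_form q p (filtered_force q).

Hypothesis psi1E : forall x, psi1 x = sinc x * phi x.
Hypothesis Asa : selfadjoint A.

(** The factorisation of [psi1] turns the kick of the scheme into [sinc] applied to a self-adjoint
    force. *)
Lemma fhOm_psi1 q :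
  fhOm psi1 h om *m (A *m (fhOm phi h om *m q)) = fhOm (@sinc R) h om *m filtered_force q.
Proof.
rewrite /filtered_force rdiagM; congr (diag_mx _ *m _).
by apply/rowP => j; rewrite !mxE psi1E.
Qed.

Lemma filtered_force_sym q1 q2 : rip q1 (filtered_force q2) = rip (filtered_force q1) q2.
Proof. by rewrite /filtered_force !(rip_rdiag, rip_selfadjoint _ _ Asa). Qed.

Lemma modified_energy_step q p :
  modified_energy (gstep om A h psi1 phi (q, p)).1 (gstep om A h psi1 phi (q, p)).2
  = modified_energy q p.
Proof.
set q' := (gstep _ _ _ _ _ _).1; set p' := (gstep _ _ _ _ _ _).2.
(* Adding the cross term <q', B q> on both sides and moving B across on the right gives exactly the
   form of [rotation_step]. *)
apply: (addIr (rip q' (filtered_force q))).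
rewrite [X in _ = _ + X]filtered_force_sym [X in _ = _ + X]ripC.
by apply: rotation_step; rewrite -!fhOm_psi1 !mulmxA.
Qed.

Lemma modified_energy_traj q p n :
  modified_energy (traj om A h psi1 phi q p n).1 (traj om A h psi1 phi q p n).2
  = modified_energy q p.
Proof.
elim: n => [//|n IH]; rewrite -[RHS]IH /traj iterS.
by case: (iter n _ _) => q' p'; exact: modified_energy_step.
Qed.


(** * Smallness of the filters in terms of min(h, 1/omega) *)

Variables c0 c1 : R.
Hypothesis om_ge0 : forall j, 0 <= om j.
Hypotheses (h_gt0 : 0 < h) (h_le1 : h <= 1) (c0_ge0 : 0 <= c0) (c1_ge0 : 0 <= c1).
Hypothesis psi1_le : forall x, `|psi1 x| <= c0.
Hypothesis phi_le : forall x, `|phi x| <= c0.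
Hypothesis phi_near1 : forall x, `|phi x - 1| <= c1 * `|x|.

Lemma min_h_invom_ge0 : 0 <= min_h_invom om h.
Proof.
rewrite /min_h_invom; case: ifP => // _.
rewrite le_min (ltW h_gt0) invr_ge0 /minfreq /=.
elim/big_rec: _ => [|j x _ x0]; last by rewrite le_min om_ge0.
by elim/big_rec: _ => [|j x _ x0]; rewrite ?lexx // le_max x0 orbT.
Qed.

Lemma minfreq_gt0 j : 0 < om j -> 0 < minfreq om.
Proof.
move=> jp; apply/bigmin_gtP; split=> //.
(* The fold of [minfreq] starts at the largest frequency, which is positive because it is at least
   [om j]. *)
by apply: lt_le_trans jp _; exact: le_bigmax.
Qed.

(** If h is the minimum, the Lipschitz bound at 0 gives L h om_j. If 1/omega is the minimum,
    boundedness suffices, since om_j / omega is at least 1 for every nonzero frequency. *)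
Lemma filter_le_min_h_invom (g : R -> R) (L : R) : 0 <= L ->
  (forall x : R, 0 <= x -> `|g x| <= L /\ `|g x| <= L * x) ->
  forall j, `|g (h * om j)| <= L * min_h_invom om h * `|om j|.
Proof.
move=> L0 gL j; have hom : 0 <= h * om j by rewrite mulr_ge0 // ltW.
have [gL1 gL2] := gL _ hom; rewrite (ger0_norm (om_ge0 j)).
have [omj0|omj0] := eqVneq (om j) 0.
  (* At a zero frequency the Lipschitz bound forces g(0) = 0; this also covers the convention for
     vanishing [om]. *)
  by move: gL2; rewrite omj0 !mulr0.
have omj : 0 < om j by rewrite lt_def omj0 om_ge0.
have [mfj ex] : minfreq om <= om j /\ [exists j, 0 < om j].
  by split; [exact: bigmin_le_cond | apply/existsP; exists j].
have mf := minfreq_gt0 omj.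
rewrite /min_h_invom ex minElt; case: ifP => _; first by rewrite -mulrA.
apply: le_trans gL1 _; rewrite -mulrA ler_peMr // mulrC.
by rewrite ler_pdivlMr // mul1r.
Qed.

(** One constant for both filters: it dominates their bound 1 + c0 and their Lipschitz constants at
    0, which are c1 and c0 + c1. *)
Let L := 1 + c0 + c1.

Lemma L_ge0 : 0 <= L.
Proof. by rewrite !addr_ge0. Qed.

Lemma phi_filter_bound (x : R) : 0 <= x -> `|1 - phi x| <= L /\ `|1 - phi x| <= L * x.
Proof.
move=> x0; have c0x := mulr_ge0 c0_ge0 x0; split.
  apply: le_trans (ler_normB _ _) _; rewrite normr1.
  by apply: le_trans (lerD (lexx 1) (phi_le x)) _; move: c1_ge0; rewrite /L; lra.
rewrite distrC; apply: le_trans (phi_near1 x) _.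
by rewrite ger0_norm // /L; lra.
Qed.

Lemma phi_cos_filter_bound (x : R) : 0 <= x ->
  `|1 - phi x * cos x| <= L /\ `|1 - phi x * cos x| <= L * x.
Proof.
move=> x0; have c0x := mulr_ge0 c0_ge0 x0; split.
  have pc : `|phi x * cos x| <= c0 by rewrite normrM -[c0]mulr1 ler_pM // cos_max.
  apply: le_trans (ler_normB _ _) _; rewrite normr1.
  by apply: le_trans (lerD (lexx 1) pc) _; move: c1_ge0; rewrite /L; lra.
have -> : 1 - phi x * cos x = (1 - phi x) + phi x * (1 - cos x) by ring.
have pc1 : `|phi x * (1 - cos x)| <= c0 * x by rewrite normrM ler_pM // one_sub_cos_le.
apply: le_trans (ler_normD _ _) _; rewrite distrC.
apply: le_trans (lerD (phi_near1 x) pc1) _.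
by rewrite ger0_norm // /L; lra.
Qed.

(** * Comparison of the modified with the true energy *)

Local Notation a := (opnorm A).

Lemma rip_cos_filtered_force q :
  rip (fhOm (@cos R) h om *m q) (filtered_force q)
  = rip (rdiag (fun j => phi (h * om j) * cos (h * om j)) *m q) (A *m (fhOm phi h om *m q)).
Proof. by rewrite /filtered_force rip_rdiag rdiagM. Qed.

Lemma vnorm_phi_cos q :
  vnorm (rdiag (fun j => phi (h * om j) * cos (h * om j)) *m q) <= c0 * vnorm q.
Proof.
apply: vnorm_rdiag_le_id => // j.
by rewrite normrM -[c0]mulr1 ler_pM // cos_max.
Qed.

Lemma vnorm_A_phi q : vnorm (A *m (fhOm phi h om *m q)) <= a * (c0 * vnorm q).
Proof.
apply: le_trans (vnorm_mulmx _ _) _; rewrite ler_wpM2l ?opnorm_ge0 //.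
by apply: vnorm_rdiag_le_id.
Qed.

Lemma rip_cos_filtered_force_le q :
  `|rip (fhOm (@cos R) h om *m q) (filtered_force q)| <= c0 ^+ 2 * a * vnorm q ^+ 2.
Proof.
rewrite rip_cos_filtered_force; apply: le_trans (rip_CauchySchwarz _ _) _.
have -> : c0 ^+ 2 * a * vnorm q ^+ 2 = c0 * vnorm q * (a * (c0 * vnorm q)) by ring.
by rewrite ler_pM ?vnorm_ge0 ?vnorm_phi_cos ?vnorm_A_phi.
Qed.

(** The outer [sinc] and the outer [phi] recombine to [psi1], which is bounded by [c0]. *)
Lemma rip_sinc_filtered_force_le q :
  rip (fhOm (@sinc R) h om *m filtered_force q) (fhOm (@sinc R) h om *m filtered_force q)
  <= (c0 ^+ 2 * a * vnorm q) ^+ 2.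
Proof.
rewrite -vnorm_sqr -fhOm_psi1.
have -> : c0 ^+ 2 * a * vnorm q = c0 * (a * (c0 * vnorm q)) by ring.
rewrite ler_sqr ?nnegrE ?mulr_ge0 ?vnorm_ge0 ?opnorm_ge0 //.
apply: (le_trans (y := c0 * vnorm (A *m (fhOm phi h om *m q)))).
  by apply: vnorm_rdiag_le_id.
by rewrite ler_wpM2l ?vnorm_A_phi.
Qed.

Lemma modified_energy_le q p : modified_energy q p
  <= vnorm p ^+ 2 + vnorm (Omega om *m q) ^+ 2 + c0 ^+ 2 * a * vnorm q ^+ 2.
Proof.
have /ler_normlP[_] := rip_cos_filtered_force_le q.
have b := rip_ge0 (fhOm (@sinc R) h om *m filtered_force q).
rewrite !vnorm_sqr /modified_energy /modified_form.
have := mulr_ge0 (sqr_ge0 h) b; move: (rip (_ *m filtered_force q) _) (h ^+ 2) => X h2.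
by move: (rip _ _) (rip _ _) => X1 X2; lra.
Qed.

(** The modified energy is solved for |Omega q|^2: |p|^2 is dropped, and h <= 1 controls the [sinc]
    term. Along a trajectory the right side depends on n only through |q_n|. *)
Lemma vnorm_Omega_le q p : vnorm (Omega om *m q) ^+ 2
  <= modified_energy q p + c0 ^+ 2 * a * vnorm q ^+ 2 + (c0 ^+ 2 * a * vnorm q) ^+ 2.
Proof.
have /ler_normlP[c _] := rip_cos_filtered_force_le q.
have := rip_sinc_filtered_force_le q.
have := rip_ge0 (fhOm (@sinc R) h om *m filtered_force q).
have h1 : h ^+ 2 <= 1 by rewrite expr_le1 // ltW.
have := rip_ge0 p; rewrite vnorm_sqr /modified_energy /modified_form.
have := sqr_ge0 h; move: c h1.
move: (rip _ _) (rip _ _) (rip (_ *m filtered_force q) _) (h ^+ 2) => ? ? ? ?.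
by nra.
Qed.

Lemma energy_defect q p :
  `|rip (Omega om *m q) (Omega om *m q) + rip p p + rip q (A *m q) - modified_energy q p|
  <= L * (1 + c0) * a * (vnorm q * vnorm (Omega om *m q)) * min_h_invom om h
     + (c0 ^+ 2 * a * vnorm q) ^+ 2 * h ^+ 2.
Proof.
set m := min_h_invom om h; set W := vnorm (Omega om *m q).
set qc := rdiag (fun j => phi (h * om j) * cos (h * om j)) *m q.
have Lm : 0 <= L * m by rewrite mulr_ge0 ?L_ge0 ?min_h_invom_ge0.
have dc : vnorm (q - qc) <= L * m * W.
  rewrite -[X in X - _]rdiag1 rdiagB; apply: vnorm_rdiag_le => //.
  exact: (filter_le_min_h_invom L_ge0 phi_cos_filter_bound).
have dp : vnorm (q - fhOm phi h om *m q) <= L * m * W.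
  rewrite -[X in X - _]rdiag1 rdiagB; apply: vnorm_rdiag_le => //.
  exact: (filter_le_min_h_invom L_ge0 phi_filter_bound).
(* The two copies of q in <q, A q> are replaced by their filtered versions one at a time. *)
have split_form : rip q (A *m q) - rip qc (A *m (fhOm phi h om *m q))
    = rip (q - qc) (A *m q) + rip qc (A *m (q - fhOm phi h om *m q)).
  by rewrite mulmxBr ripBl ripBr; ring.
have b1 : `|rip (q - qc) (A *m q)| <= L * m * W * (a * vnorm q).
  apply: le_trans (rip_CauchySchwarz _ _) _.
  exact: ler_pM (vnorm_ge0 _) (vnorm_ge0 _) dc (vnorm_mulmx _ _).
have b2 : `|rip qc (A *m (q - fhOm phi h om *m q))| <= c0 * vnorm q * (a * (L * m * W)).
  apply: le_trans (rip_CauchySchwarz _ _) _.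
  rewrite ler_pM ?vnorm_ge0 ?vnorm_phi_cos //.
  by apply: le_trans (vnorm_mulmx _ _) _; rewrite ler_wpM2l ?opnorm_ge0.
have b3 := rip_sinc_filtered_force_le q.
have b4 := rip_ge0 (fhOm (@sinc R) h om *m filtered_force q).
rewrite /modified_energy /modified_form rip_cos_filtered_force -/qc.
set X := rip (_ *m filtered_force q) _ in b3 b4 *.
have -> : rip (Omega om *m q) (Omega om *m q) + rip p p + rip q (A *m q)
    - (rip p p + rip (Omega om *m q) (Omega om *m q) + rip qc (A *m (fhOm phi h om *m q))
       + - (h ^+ 2 / 4) * X)
  = rip (q - qc) (A *m q) + rip qc (A *m (q - fhOm phi h om *m q)) + h ^+ 2 / 4 * X.
  by rewrite -split_form; ring.
apply: le_trans (ler_normD _ _) _; apply: lerD.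
  apply: le_trans (ler_normD _ _) _; apply: le_trans (lerD b1 b2) _.
  by rewrite le_eqVlt; apply/orP; left; apply/eqP; ring.
have X0 : 0 <= h ^+ 2 / 4 * X.
  by apply: mulr_ge0 b4; apply: mulr_ge0 (sqr_ge0 _) _; rewrite invr_ge0 ler0n.
rewrite ger0_norm //.
rewrite mulrAC -mulrA mulrC ler_wpM2r ?sqr_ge0 //.
by apply: le_trans b3; rewrite ler_pdivrMr //; apply: ler_peMr b4 _; rewrite ler1n.
Qed.

End ModifiedEnergy.

Theorem theorem4 (R : realType) :
  exists C : R -> R -> R -> R -> R -> R -> R -> R,
  forall (d : nat) (om : 'I_d -> R) (A : 'M[R[i]]_d) (h c0 c1 : R)
         (psi1 phi : R -> R) (q0 qd0 : 'cV[R[i]]_d),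
    (0 < d)%N ->
    (forall j, 0 <= om j) ->
    selfadjoint A ->
    0 < h -> h <= 1 ->
    0 <= c0 -> 0 <= c1 ->
    (forall x, psi1 (- x) = psi1 x) ->
    (forall x, phi (- x) = phi x) ->
    (forall x, psi1 x = sinc x * phi x) ->
    (forall x, `|psi1 x| <= c0) ->
    (forall x, `|phi x| <= c0) ->
    (forall x, `|phi x - 1| <= c1 * `|x|) ->
    forall n : nat,
      let qn := (traj om A h psi1 phi q0 qd0 n).1 in
      let qdn := (traj om A h psi1 phi q0 qd0 n).2 in
      let K := C c0 c1 (opnorm A) (vnorm q0) (vnorm (Omega om *m q0))
                 (vnorm qd0) (vnorm qn) in
      cabs (energy om A qn qdn - energy om A q0 qd0)
        <= K * min_h_invom om h + K * h ^+ 2.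
Proof.
(* [Wn] will bound |Omega q_n|, on which the constant may not depend: it combines [vnorm_Omega_le]
   at time n with [modified_energy_le] at time 0. [Kh] and [Kh2] add the coefficients of
   [energy_defect] at both times. *)
pose Wn (c0 a Q0 W0 P0 Qn : R) : R := Num.sqrt
  (P0 ^+ 2 + W0 ^+ 2 + c0 ^+ 2 * a * Q0 ^+ 2 + c0 ^+ 2 * a * Qn ^+ 2 + (c0 ^+ 2 * a * Qn) ^+ 2).
pose Kh (c0 c1 a Q0 W0 P0 Qn : R) :=
  (1 + c0 + c1) * (1 + c0) * a * (Q0 * W0 + Qn * Wn c0 a Q0 W0 P0 Qn).
pose Kh2 (c0 a Q0 Qn : R) := (c0 ^+ 2 * a * Q0) ^+ 2 + (c0 ^+ 2 * a * Qn) ^+ 2.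
(* The same constant multiplies both error terms, so the two nonnegative coefficients are added. *)
exists (fun c0 c1 a Q0 W0 P0 Qn => Kh c0 c1 a Q0 W0 P0 Qn + Kh2 c0 a Q0 Qn).
move=> d om A h c0 c1 psi1 phi q0 p0 _ om0 Asa h0 h1 c00 c10 _ _ psiE psic phic phi1 n.
cbv zeta; set qn := (traj _ _ _ _ _ _ _ n).1; set pn := (traj _ _ _ _ _ _ _ n).2.
have cons : modified_energy om A h phi qn pn = modified_energy om A h phi q0 p0.
  exact: modified_energy_traj.
have D0 := energy_defect A psiE om0 h0 c00 c10 psic phic phi1 q0 p0.
have Dn := energy_defect A psiE om0 h0 c00 c10 psic phic phi1 qn pn.
have Wle : vnorm (Omega om *m qn)
    <= Wn c0 (opnorm A) (vnorm q0) (vnorm (Omega om *m q0)) (vnorm p0) (vnorm qn).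
  apply: vnorm_le_sqrt.
  apply: le_trans (vnorm_Omega_le om A psiE h0 h1 c00 psic phic qn pn) _.
  by rewrite cons !lerD2r; exact: (modified_energy_le om A h c00 phic).
rewrite (energyE om qn pn Asa) (energyE om q0 p0 Asa) cabs_cRB.
rewrite cons in Dn; move: D0 Dn; set M := modified_energy _ _ _ _ q0 p0.
set E0 := _ + rip q0 _; set En := _ + rip qn _ => D0 Dn.
have m0 : 0 <= min_h_invom om h := min_h_invom_ge0 om0 h0.
have h20 := sqr_ge0 h.
have a0 := opnorm_ge0 A.
have L0 : 0 <= (1 + c0 + c1) * (1 + c0) * opnorm A by rewrite !mulr_ge0 ?addr_ge0.
have Kh_ge : (1 + c0 + c1) * (1 + c0) * opnorm A * (vnorm q0 * vnorm (Omega om *m q0))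
    + (1 + c0 + c1) * (1 + c0) * opnorm A * (vnorm qn * vnorm (Omega om *m qn))
    <= Kh c0 c1 (opnorm A) (vnorm q0) (vnorm (Omega om *m q0)) (vnorm p0) (vnorm qn).
  rewrite /Kh -mulrDr; apply: (ler_wpM2l L0); rewrite lerD2l.
  exact: (ler_wpM2l (vnorm_ge0 qn) Wle).
have Kh0 : 0 <= Kh c0 c1 (opnorm A) (vnorm q0) (vnorm (Omega om *m q0)) (vnorm p0) (vnorm qn).
  apply: le_trans (addr_ge0 _ _) Kh_ge; apply: (mulr_ge0 L0).
    exact: mulr_ge0 (vnorm_ge0 _) (vnorm_ge0 _).
  exact: mulr_ge0 (vnorm_ge0 _) (vnorm_ge0 _).
have Kh20 : 0 <= Kh2 c0 (opnorm A) (vnorm q0) (vnorm qn) by rewrite addr_ge0 ?sqr_ge0.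
have half0 : 0 <= 1 / 2 :> R by rewrite divr_ge0.
rewrite -mulrBr normrM (ger0_norm half0).
(* Conservation gives both times the same modified energy [M], so the energy error is a difference
   of two defects. *)
have -> : En - E0 = (En - M) - (E0 - M) by ring.
apply: (le_trans (ler_wpM2l half0 (le_trans (ler_normB _ _) (lerD Dn D0)))).
have := ler_wpM2r m0 Kh_ge.
have := mulr_ge0 Kh0 m0; have := mulr_ge0 Kh20 m0.
have := mulr_ge0 Kh0 h20; have := mulr_ge0 Kh20 h20; rewrite /Kh2.
move: (Kh _ _ _ _ _ _ _) (min_h_invom om h) => K m.
move: (_ * (vnorm q0 * _)) (_ * (vnorm qn * _)) => k0 kn.
move: ((_ * vnorm q0) ^+ 2) ((_ * vnorm qn) ^+ 2) (h ^+ 2) => b0 bn h2.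
by clear; lra.
Qed.
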